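(* Let $(\mathcal C,\alpha)$ be a grading category, let $A$ and $B$ be $\mathcal C$-graded algebras, and suppose that the unitors of $\mathrm{Mod}^{\mathcal C}$ are the typical unitors induced by $\alpha$. Then every $\mathcal C$-graded left $A\otimes_\Bbbk B^{\mathrm{op}}$-module can be given the structure of a $\mathcal C$-graded $(A,B)$-bimodule, and vice versa (on the same underlying $\mathcal C$-graded $\Bbbk$-module).
   Context: Let $\Bbbk$ be a commutative unital ring with unit group $\Bbbk^\times$ and $\mathcal C$ a small category. A grading category $(\mathcal C,\alpha)$: $\alpha$ assigns to each composable triple $(f_1,f_2,f_3)$ (so $f_3\circ f_2\circ f_1$ is defined) an element of $\Bbbk^\times$ such that for all composable $(f_1,f_2,f_3,f_4)$: $\alpha(f_1,f_2,f_3)\,\alpha(f_1,f_2,f_4\circ f_3)^{-1}\alpha(f_1,f_3\circ f_2,f_4)\,\alpha(f_2\circ f_1,f_3,f_4)^{-1}\alpha(f_2,f_3,f_4)=1$. A $\mathcal C$-graded module is a $\Bbbk$-module $M=\bigoplus_{g\in\mathrm{Mor}(\mathcal C)}M_g$; write $|x|=g$ for $x\in M_g$. Graded maps are $\Bbbk$-linear and preserve each $M_g$. $(M\otimes N)_g=\bigoplus_{g=g_2\circ g_1}M_{g_1}\otimes_\Bbbk N_{g_2}$ (products of elements with non-composable degrees are zero). Typical unitor constants: for $g:X\to Y$, $\mathcal L(\mathrm{Id}_X,g)=\alpha(\mathrm{Id}_X,\mathrm{Id}_X,g)^{-1}$, $\mathcal R(g,\mathrm{Id}_Y)=\alpha(g,\mathrm{Id}_Y,\mathrm{Id}_Y)$.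 A $\mathcal C$-graded algebra is a $\mathcal C$-graded module $A$ with a graded $\Bbbk$-linear $\mu_A:A\otimes A\to A$ (so $|\mu_A(x,y)|=|y|\circ|x|$) and elements $1_X\in A_{\mathrm{Id}_X}$ with, for homogeneous elements, $\mu_A(\mu_A(x,y),z)=\alpha(|x|,|y|,|z|)\mu_A(x,\mu_A(y,z))$, $\mu_A(1_X,x)=\mathcal L(\mathrm{Id}_X,|x|)x$, $\mu_A(x,1_Y)=\mathcal R(|x|,\mathrm{Id}_Y)x$ if $|x|:X\to Y$. A $\mathcal C$-graded $(A,B)$-bimodule is a $\mathcal C$-graded module $M$ with graded maps $\rho_L:A\otimes M\to M$, $\rho_R:M\otimes B\to M$ such that $\rho_L(\mu_A(a,a'),m)=\alpha(|a|,|a'|,|m|)\rho_L(a,\rho_L(a',m))$, $\rho_R(\rho_R(m,b),b')=\alpha(|m|,|b|,|b'|)\rho_R(m,\mu_B(b,b'))$, $\rho_R(\rho_L(a,m),b)=\alpha(|a|,|m|,|b|)\rho_L(a,\rho_R(m,b))$, $\rho_L(1_X,m)=\mathcal L(\mathrm{Id}_X,|m|)m$, $\rho_R(m,1_Y)=\mathcal R(|m|,\mathrm{Id}_Y)m$ for $|m|:X\to Y$. $A\otimes_\Bbbk B^{\mathrm{op}}$ has product $\mu(a_1\otimes b_1,a_2\otimes b_2)=\mu_A(a_1,a_2)\otimes\mu_B(b_2,b_1)$. A $\mathcal C$-graded left $A\otimes_\Bbbk B^{\mathrm{op}}$-module is a $\mathcal C$-graded module $M$ with a $\Bbbk$-bilinear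 map $\rho_L^e:(A\otimes_\Bbbk B^{\mathrm{op}})\times M\to M$ such that, for homogeneous elements, $|\rho_L^e(a\otimes b,m)|=|b|\circ|m|\circ|a|$ (and $\rho^e_L(a\otimes b,m)=0$ if this is not composable), and (E.I) $\rho_L^e(\mu(a_1\otimes b_1,a_2\otimes b_2),m)=\Delta\cdot\rho_L^e(a_1\otimes b_1,\rho_L^e(a_2\otimes b_2,m))$ with $\Delta=\alpha(|a_1|,|a_2|,|m|)\,\alpha(|m|\circ|a_2|\circ|a_1|,|b_2|,|b_1|)^{-1}\,\alpha(|a_1|,|m|\circ|a_2|,|b_2|)$ (all degrees taken in $\mathcal C$); (E.II) $\rho_L^e(1_X\otimes1_Y,m)=\mathcal L(\mathrm{Id}_X,|m|)\,\mathcal R(|m|,\mathrm{Id}_Y)\,m$ for $|m|:X\to Y$. *)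

(* Defs.v *)
From HB Require Import structures.
From mathcomp Require Import all_boot all_algebra.
From mathcomp Require Import generic_quotient boolp.

Set Implicit Arguments.
Unset Strict Implicit.
Unset Printing Implicit Defensive.

Import GRing.Theory.
Local Open Scope ring_scope.
Local Open Scope quotient_scope.

(* [comPzRingType] rather than [comUnitRingType]: the ground ring is allowed
   to be zero and no decision procedure for invertibility is assumed.  As
   [GRing.unit] is only available for non-zero rings, the unit group is
   defined here.  Two units are compared through [uval]. *)

Record unitgrp (k : comPzRingType) : Type := UnitGrp {
  uval : k;
  uinv : k;
  uvalK : uval * uinv = 1 }.

(* The library's [bilinear] requires a non-zero ring of scalars. *)
Definition is_bilinear (k : comPzRingType) (U V W : lmodType k)
    (f : U -> V -> W) : Prop :=
  (forall u, linear (f u)) /\ (forall v, linear (f^~ v)).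

(* The tensor product over k of two k-modules, by generators and relations:
   a list [:: (a_1, b_1); ...; (a_n, b_n)] stands for the formal sum of the
   a_i (x) b_i, and formal sums are identified along the least congruence
   containing commutativity and the bilinearity relations.  No formal
   coefficients are needed, since c (a (x) b) = (c a) (x) b. *)

Inductive tens_rel (k : comPzRingType) (A B : lmodType k) :
    seq (A * B) -> seq (A * B) -> Prop :=
| tens_refl s : tens_rel s s
| tens_sym s t : tens_rel s t -> tens_rel t s
| tens_trans s t u : tens_rel s t -> tens_rel t u -> tens_rel s u
| tens_cat s s' t t' :
    tens_rel s s' -> tens_rel t t' -> tens_rel (s ++ t) (s' ++ t')
| tens_comm s t : tens_rel (s ++ t) (t ++ s)
| tens_zero b : tens_rel [:: (0, b)] [::]
| tens_addl a a' b : tens_rel [:: (a + a', b)] [:: (a, b); (a', b)]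
| tens_addr a b b' : tens_rel [:: (a, b + b')] [:: (a, b); (a, b')]
| tens_scale c a b : tens_rel [:: (c *: a, b)] [:: (a, c *: b)].

Section Tensor.
Variables (k : comPzRingType) (A B : lmodType k).
Implicit Types (s t : seq (A * B)) (c : k).

Definition tens_eqb : rel (seq (A * B)) := fun s t => `[< tens_rel s t >].

Lemma tens_eqb_refl : reflexive tens_eqb.
Proof. by move=> s; apply/asboolP/tens_refl. Qed.

Lemma tens_eqb_sym : symmetric tens_eqb.
Proof. by move=> s t; apply/asboolP/asboolP => /tens_sym. Qed.

Lemma tens_eqb_trans : transitive tens_eqb.
Proof.
move=> t s u /asboolP st /asboolP tu; apply/asboolP; exact: tens_trans st tu.
Qed.

Canonical tens_equiv :=
  EquivRel tens_eqb tens_eqb_refl tens_eqb_sym tens_eqb_trans.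

Definition tensor : Type := {eq_quot tens_equiv}.
HB.instance Definition _ := Choice.on tensor.
HB.instance Definition _ := EqQuotient.on tensor.

Definition tensor_of (s : seq (A * B)) : tensor := \pi_tensor s.

Lemma tensor_ofP s t : tensor_of s = tensor_of t <-> tens_rel s t.
Proof.
split=> [/eqmodP /asboolP // | st]; apply/eqmodP; exact/asboolP.
Qed.

Lemma tensor_repr (x : tensor) : exists s, x = tensor_of s.
Proof. by exists (repr x); rewrite /tensor_of reprK. Qed.

Lemma repr_tensor_of s : tens_rel (repr (tensor_of s)) s.
Proof. by apply/tensor_ofP; rewrite /tensor_of reprK. Qed.

Definition tens (a : A) (b : B) : tensor := tensor_of [:: (a, b)].

Definition scale_sum c s : seq (A * B) := [seq (c *: p.1, p.2) | p <- s].

Definition tensor_add (x y : tensor) : tensor := tensor_of (repr x ++ repr y).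
Definition tensor_scale c (x : tensor) : tensor :=
  tensor_of (scale_sum c (repr x)).
Definition tensor_zero : tensor := tensor_of [::].
Definition tensor_opp (x : tensor) : tensor := tensor_scale (-1) x.

Lemma tensor_addE s t :
  tensor_add (tensor_of s) (tensor_of t) = tensor_of (s ++ t).
Proof. by apply/tensor_ofP/tens_cat; exact: repr_tensor_of. Qed.

Lemma scale_sum_rel c s t :
  tens_rel s t -> tens_rel (scale_sum c s) (scale_sum c t).
Proof.
elim=> {s t} /=.
- by move=> s; exact: tens_refl.
- by move=> s t _ /tens_sym.
- by move=> s t u _ st _ tu; exact: tens_trans st tu.
- by move=> s s' t t' _ ? _ ?; rewrite /scale_sum !map_cat; exact: tens_cat.
- by move=> s t; rewrite /scale_sum !map_cat; exact: tens_comm.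
- by move=> b; rewrite scaler0; exact: tens_zero.
- by move=> a a' b; rewrite scalerDr; exact: tens_addl.
- by move=> a b b'; exact: tens_addr.
- move=> d a b; rewrite scalerA mulrC -scalerA; exact: tens_scale.
Qed.

Lemma tensor_scaleE c s :
  tensor_scale c (tensor_of s) = tensor_of (scale_sum c s).
Proof. by apply/tensor_ofP/scale_sum_rel; exact: repr_tensor_of. Qed.

Lemma tensor_addA : associative tensor_add.
Proof.
move=> x y z; have [s ->] := tensor_repr x; have [t ->] := tensor_repr y.
by have [u ->] := tensor_repr z; rewrite !tensor_addE catA.
Qed.

Lemma tensor_addC : commutative tensor_add.
Proof.
move=> x y; have [s ->] := tensor_repr x; have [t ->] := tensor_repr y.
by rewrite !tensor_addE; apply/tensor_ofP/tens_comm.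
Qed.

Lemma tensor_add0 : left_id tensor_zero tensor_add.
Proof. by move=> x; have [s ->] := tensor_repr x; rewrite tensor_addE. Qed.

Lemma scale_sumDl c d s :
  tens_rel (scale_sum (c + d) s) (scale_sum c s ++ scale_sum d s).
Proof.
elim: s => [|[a b] s IHs] /=; first exact: tens_refl.
rewrite scalerDl -cat1s.
apply: tens_trans (tens_cat (tens_addl _ _ _) IHs) _.
apply: (@tens_cat k A B [:: (c *: a, b)] [:: (c *: a, b)]
  ([:: (d *: a, b)] ++ (scale_sum c s ++ scale_sum d s))
  (scale_sum c s ++ ([:: (d *: a, b)] ++ scale_sum d s))).
  exact: tens_refl.
rewrite !catA; apply: tens_cat; last exact: tens_refl.
exact: tens_comm.
Qed.

Lemma scale_sum0 s : tens_rel (scale_sum 0 s) [::].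
Proof.
elim: s => [|[a b] s IHs] /=; first exact: tens_refl.
rewrite scale0r.
exact: (@tens_cat k A B [:: (0, b)] [::] _ [::] (tens_zero A b) IHs).
Qed.

Lemma tensor_addN : left_inverse tensor_zero tensor_opp tensor_add.
Proof.
move=> x; have [s ->] := tensor_repr x.
rewrite /tensor_opp tensor_scaleE tensor_addE; apply/tensor_ofP.
apply: tens_trans (scale_sum0 s); rewrite -(addNr (1 : k)).
apply: tens_trans (tens_sym (scale_sumDl _ _ _)).
apply: tens_cat; first exact: tens_refl.
rewrite /scale_sum (eq_map (g := id)) ?map_id; first exact: tens_refl.
by case=> a b /=; rewrite scale1r.
Qed.

HB.instance Definition _ :=
  GRing.isZmodule.Build tensor tensor_addA tensor_addC tensor_add0 tensor_addN.

Lemma tensor_scaleA c d (x : tensor) :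
  tensor_scale c (tensor_scale d x) = tensor_scale (c * d) x.
Proof.
have [s ->] := tensor_repr x; rewrite !tensor_scaleE /scale_sum -map_comp.
by congr tensor_of; apply: eq_map => -[a b] /=; rewrite scalerA.
Qed.

Lemma tensor_scale1 : left_id 1 tensor_scale.
Proof.
move=> x; have [s ->] := tensor_repr x; rewrite tensor_scaleE /scale_sum.
by rewrite (eq_map (g := id)) ?map_id // => -[a b] /=; rewrite scale1r.
Qed.

Lemma tensor_scaleDr : right_distributive tensor_scale +%R.
Proof.
move=> c x y; have [s ->] := tensor_repr x; have [t ->] := tensor_repr y.
change (tensor_scale c (tensor_add (tensor_of s) (tensor_of t)) =
  tensor_add (tensor_scale c (tensor_of s)) (tensor_scale c (tensor_of t))).
by rewrite tensor_addE !tensor_scaleE tensor_addE /scale_sum map_cat.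
Qed.

Lemma tensor_scaleDl (x : tensor) :
  {morph tensor_scale^~ x : c d / c + d >-> c + d}.
Proof.
move=> c d; have [s ->] := tensor_repr x.
change (tensor_scale (c + d) (tensor_of s) =
  tensor_add (tensor_scale c (tensor_of s)) (tensor_scale d (tensor_of s))).
by rewrite !tensor_scaleE tensor_addE; apply/tensor_ofP/scale_sumDl.
Qed.

HB.instance Definition _ := GRing.Zmodule_isLmodule.Build k tensor
  tensor_scaleA tensor_scale1 tensor_scaleDr tensor_scaleDl.

Lemma tens_bilinear : is_bilinear tens.
Proof.
split=> [a c b b' | b c a a'].
- rewrite -[RHS]/(tensor_add (tensor_scale c (tens a b)) (tens a b')).
  rewrite tensor_scaleE tensor_addE; apply/tensor_ofP.
  apply: tens_trans (tens_addr _ _ _) _; rewrite -cat1s.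
  by apply: tens_cat (tens_refl _); apply/tens_sym/tens_scale.
- rewrite -[RHS]/(tensor_add (tensor_scale c (tens a b)) (tens a' b)).
  by rewrite tensor_scaleE tensor_addE; apply/tensor_ofP/tens_addl.
Qed.

Lemma tensor_ofE s : tensor_of s = \sum_(p <- s) tens p.1 p.2.
Proof.
elim: s => [|[a b] s IHs]; first by rewrite big_nil.
by rewrite big_cons -IHs -[RHS]/(tensor_add _ _) tensor_addE.
Qed.

Section Lift.
Variable W : lmodType k.

(* The linear map on the tensor product induced by a bilinear map [f];
   meaningless if [f] is not bilinear. *)
Definition tlift (f : A -> B -> W) (x : tensor) : W :=
  \sum_(p <- repr x) f p.1 p.2.

Variable f : A -> B -> W.
Hypothesis bil_f : is_bilinear f.

Lemma tlift_rel s t : tens_rel s t ->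
  \sum_(p <- s) f p.1 p.2 = \sum_(p <- t) f p.1 p.2.
Proof.
have [fl fr] := bil_f.
have f0 b : f 0 b = 0.
  by have /= := fr b (-1) 0 0; rewrite scaler0 addr0 scaleN1r addNr.
have fr0 a : f a 0 = 0.
  by have /= := fl a (-1) 0 0; rewrite scaler0 addr0 scaleN1r addNr.
elim=> {s t} //=.
- by move=> s t u _ -> _ ->.
- by move=> s s' t t' _ ss' _ tt'; rewrite !big_cat /= ss' tt'.
- by move=> s t; rewrite !big_cat /= addrC.
- by move=> b; rewrite big_seq1 big_nil f0.
- move=> a a' b; rewrite big_seq1 big_cons big_seq1 /=.
  by have /= := fr b 1 a a'; rewrite !scale1r.
- move=> a b b'; rewrite big_seq1 big_cons big_seq1 /=.
  by have /= := fl a 1 b b'; rewrite !scale1r.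
- move=> c a b; rewrite !big_seq1 /=.
  have /= := fr b c a 0; have /= := fl a c b 0.
  by rewrite !addr0 f0 fr0 !addr0 => -> ->.
Qed.

Lemma tlift_of s : tlift f (tensor_of s) = \sum_(p <- s) f p.1 p.2.
Proof. exact/tlift_rel/repr_tensor_of. Qed.

Lemma tlift_tens a b : tlift f (tens a b) = f a b.
Proof. by rewrite tlift_of big_seq1. Qed.

Lemma tlift_linear : linear (tlift f).
Proof.
move=> c x y; have [s ->] := tensor_repr x; have [t ->] := tensor_repr y.
rewrite -[c *: tensor_of s + _]/(tensor_add (tensor_scale c _) _).
rewrite tensor_scaleE tensor_addE !tlift_of big_cat big_map /=; congr (_ + _).
rewrite scaler_sumr; apply: eq_bigr => -[a b] _ /=.
have /= := bil_f.2 b c a 0; rewrite addr0 => ->.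
by have /= := bil_f.2 b (-1) 0 0;
  rewrite scaler0 addr0 scaleN1r addNr => ->; rewrite addr0.
Qed.

End Lift.

Lemma tlift_comb (W : lmodType k) (c : k) (f g h : A -> B -> W) (x : tensor) :
  (forall a b, h a b = c *: f a b + g a b) ->
  tlift h x = c *: tlift f x + tlift g x.
Proof.
by move=> hE; rewrite scaler_sumr -big_split; apply: eq_bigr => p _; rewrite hE.
Qed.

Lemma tlift_unique (W : lmodType k) (g h : tensor -> W) :
  linear g -> linear h ->
  (forall a b, g (tens a b) = h (tens a b)) -> g =1 h.
Proof.
move=> lin_g lin_h gh x; have [s ->] := tensor_repr x; rewrite tensor_ofE.
have lin0 (l : tensor -> W) : linear l -> l 0 = 0.
  by move=> /(_ (-1) 0 0); rewrite scaler0 addr0 scaleN1r addNr.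
elim: s => [|p s IHs]; first by rewrite big_nil !lin0.
rewrite big_cons -[tens _ _]scale1r lin_g lin_h gh.
by congr (_ + _); exact: IHs.
Qed.

End Tensor.

Record category : Type := Category {
  obj :> Type;
  hom : obj -> obj -> Type;
  idm : forall X, hom X X;
  comp : forall X Y Z, hom Y Z -> hom X Y -> hom X Z;
  comp_idl : forall X Y (f : hom X Y), comp (idm Y) f = f;
  comp_idr : forall X Y (f : hom X Y), comp f (idm X) = f;
  comp_assoc : forall W X Y Z (f : hom W X) (g : hom X Y) (h : hom Y Z),
    comp h (comp g f) = comp (comp h g) f }.

Arguments idm {c} X.
Arguments comp {c X Y Z} g f.

Notation "g '\oc' f" := (comp g f) (at level 50, left associativity).

Record mor (C : category) : Type := Mor { src : C; tgt : C; arr : hom src tgt }.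

(* The arguments f1, f2, f3 are in diagrammatic order: f3 \oc f2 \oc f1 is the
   composite. *)
Definition is_associator (k : comPzRingType) (C : category)
    (alpha : forall (W X Y Z : C),
       hom W X -> hom X Y -> hom Y Z -> unitgrp k) : Prop :=
  forall (V W X Y Z : C) (f1 : hom V W) (f2 : hom W X) (f3 : hom X Y)
         (f4 : hom Y Z),
    uval (alpha _ _ _ _ f1 f2 f3)
    * uinv (alpha _ _ _ _ f1 f2 (f4 \oc f3))
    * uval (alpha _ _ _ _ f1 (f3 \oc f2) f4)
    * uinv (alpha _ _ _ _ (f2 \oc f1) f3 f4)
    * uval (alpha _ _ _ _ f2 f3 f4) = 1.

Record grading_category (k : comPzRingType) : Type := GradingCategory {
  gcat :> category;
  alpha : forall (W X Y Z : gcat),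
    hom W X -> hom X Y -> hom Y Z -> unitgrp k;
  alpha_cocycle : is_associator alpha }.

Arguments alpha {k} C {W X Y Z} f1 f2 f3 : rename.

(* [lunitor g] and [runitor g], for g : X -> Y, are the constants
   L(Id_X, g) and R(g, Id_Y). *)
Record unitors (k : comPzRingType) (C : category) : Type := Unitors {
  lunitor : forall (X Y : C), hom X Y -> unitgrp k;
  runitor : forall (X Y : C), hom X Y -> unitgrp k }.

Arguments lunitor {k C} u {X Y} g.
Arguments runitor {k C} u {X Y} g.

Definition typical_unitors (k : comPzRingType) (C : grading_category k)
    (u : unitors k C) : Prop :=
  forall (X Y : C) (g : hom X Y),
    uval (lunitor u g) = uinv (alpha C (idm X) (idm X) g)
    /\ uval (runitor u g) = uval (alpha C g (idm Y) (idm Y)).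

(* A k-module that is the internal direct sum of submodules [piece f], f
   ranging over all morphisms: every element is a finite sum of homogeneous
   elements, and homogeneous elements of pairwise distinct degrees are
   independent. *)
Record graded_module (k : comPzRingType) (C : category) : Type := GradedModule {
  gcarrier :> lmodType k;
  piece : forall (X Y : C), hom X Y -> gcarrier -> Prop;
  piece0 : forall (X Y : C) (f : hom X Y), piece f 0;
  pieceP : forall (X Y : C) (f : hom X Y) (c : k) (x y : gcarrier),
    piece f x -> piece f y -> piece f (c *: x + y);
  piece_span : forall v : gcarrier,
    exists (n : nat) (d : 'I_n -> mor C) (x : 'I_n -> gcarrier),
      (forall i, piece (arr (d i)) (x i)) /\ v = \sum_(i < n) x i;
  piece_indep : forall (n : nat) (d : 'I_n -> mor C) (x : 'I_n -> gcarrier),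
    injective d -> (forall i, piece (arr (d i)) (x i)) ->
    \sum_(i < n) x i = 0 -> forall i, x i = 0 }.

Arguments piece {k C} M {X Y} f x : rename.

(* A graded map M (x) N -> P, as a bilinear map: the degree-g part of
   M (x) N is the sum of the M_{g1} (x)_k N_{g2} over g = g2 \oc g1, and
   products of homogeneous elements of non-composable degrees vanish. *)
Definition is_graded_pairing (k : comPzRingType) (C : category)
    (M N P : graded_module k C) (f : M -> N -> P) : Prop :=
  [/\ is_bilinear f,
      forall (X Y Z : C) (g1 : hom X Y) (g2 : hom Y Z) (x : M) (y : N),
        piece M g1 x -> piece N g2 y -> piece P (g2 \oc g1) (f x y)
    & forall (X Y Y' Z : C) (g1 : hom X Y) (g2 : hom Y' Z) (x : M) (y : N),
        Y <> Y' -> piece M g1 x -> piece N g2 y -> f x y = 0].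

(* In all the axioms below, identities between homogeneous elements of
   non-composable degrees are omitted: both sides are then zero, and alpha is
   not defined. *)
Record graded_algebra (k : comPzRingType) (C : grading_category k)
    (u : unitors k C) : Type := GradedAlgebra {
  acarrier :> graded_module k C;
  amul : acarrier -> acarrier -> acarrier;
  aone : C -> acarrier;
  amul_graded : is_graded_pairing amul;
  aone_piece : forall X : C, piece acarrier (idm X) (aone X);
  amulA : forall (W X Y Z : C) (f : hom W X) (g : hom X Y) (h : hom Y Z)
      (x y z : acarrier),
    piece acarrier f x -> piece acarrier g y -> piece acarrier h z ->
    amul (amul x y) z = uval (alpha C f g h) *: amul x (amul y z);
  amul1l : forall (X Y : C) (f : hom X Y) (x : acarrier),
    piece acarrier f x -> amul (aone X) x = uval (lunitor u f) *: x;
  amul1r : forall (X Y : C) (f : hom X Y) (x : acarrier),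
    piece acarrier f x -> amul x (aone Y) = uval (runitor u f) *: x }.

Arguments aone {k C u} A X : rename.

Record is_graded_bimodule (k : comPzRingType) (C : grading_category k)
    (u : unitors k C) (A B : graded_algebra u) (M : graded_module k C)
    (rhoL : A -> M -> M) (rhoR : M -> B -> M) : Prop := IsGradedBimodule {
  rhoL_graded : is_graded_pairing rhoL;
  rhoR_graded : is_graded_pairing rhoR;
  rhoL_mul : forall (W X Y Z : C) (f : hom W X) (f' : hom X Y) (g : hom Y Z)
      (a a' : A) (m : M),
    piece A f a -> piece A f' a' -> piece M g m ->
    rhoL (amul a a') m = uval (alpha C f f' g) *: rhoL a (rhoL a' m);
  rhoR_mul : forall (W X Y Z : C) (g : hom W X) (h : hom X Y) (h' : hom Y Z)
      (m : M) (b b' : B),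
    piece M g m -> piece B h b -> piece B h' b' ->
    rhoR (rhoR m b) b' = uval (alpha C g h h') *: rhoR m (amul b b');
  rhoLR : forall (W X Y Z : C) (f : hom W X) (g : hom X Y) (h : hom Y Z)
      (a : A) (m : M) (b : B),
    piece A f a -> piece M g m -> piece B h b ->
    rhoR (rhoL a m) b = uval (alpha C f g h) *: rhoL a (rhoR m b);
  rhoL1 : forall (X Y : C) (g : hom X Y) (m : M),
    piece M g m -> rhoL (aone A X) m = uval (lunitor u g) *: m;
  rhoR1 : forall (X Y : C) (g : hom X Y) (m : M),
    piece M g m -> rhoR m (aone B Y) = uval (runitor u g) *: m }.

(* The product of A (x)_k B^op, determined by [env_mul_tens]. *)
Definition env_mul (k : comPzRingType) (C : grading_category k)
    (u : unitors k C) (A B : graded_algebra u) (x y : tensor A B) :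
    tensor A B :=
  tlift (fun a1 b1 => tlift (fun a2 b2 => tens (amul a1 a2) (amul b2 b1)) y) x.

Section EnvMul.
Variables (k : comPzRingType) (C : grading_category k) (u : unitors k C).
Variables A B : graded_algebra u.

Let F (a1 : A) (b1 : B) (a2 : A) (b2 : B) : tensor A B :=
  tens (amul a1 a2) (amul b2 b1).

Let F_bilinear a1 b1 : is_bilinear (F a1 b1).
Proof.
have [[tl tr] [[al _] _ _] [[_ br] _ _]] :=
  And3 (tens_bilinear A B) (amul_graded A) (amul_graded B).
by split=> [a2 | b2] c x y; rewrite /F ?al (br, tl, tr) ?tl ?tr.
Qed.

Let G_bilinear (y : tensor A B) : is_bilinear (fun a b => tlift (F a b) y).
Proof.
have [[tl tr] [[_ ar] _ _] [[bl _] _ _]] :=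
  And3 (tens_bilinear A B) (amul_graded A) (amul_graded B).
split=> [a1 | b1] c x x'; apply: tlift_comb => a2 b2; rewrite /F.
  by rewrite bl tl.
by rewrite ar tr.
Qed.

Lemma env_mul_bilinear : is_bilinear (@env_mul k C u A B).
Proof.
split=> [x c y y' | y c x x'].
  by apply: tlift_comb => a b; rewrite (tlift_linear (F_bilinear a b)).
exact: (tlift_linear (G_bilinear y)).
Qed.

Lemma env_mul_tens (a1 a2 : A) (b1 b2 : B) :
  env_mul (tens a1 b1) (tens a2 b2) = tens (amul a1 a2) (amul b2 b1).
Proof.
by rewrite /env_mul (tlift_tens (G_bilinear _)) (tlift_tens (F_bilinear _ _)).
Qed.

End EnvMul.

(* A graded left (A (x)_k B^op)-module structure.  The factors are in
   diagrammatic order a, m, b, so that |rhoE (a (x) b) m| = |b| o |m| o |a|. *)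
Record is_graded_env_module (k : comPzRingType) (C : grading_category k)
    (u : unitors k C) (A B : graded_algebra u) (M : graded_module k C)
    (rhoE : tensor A B -> M -> M) : Prop := IsGradedEnvModule {
  rhoE_bilinear : is_bilinear rhoE;
  rhoE_piece : forall (W X Y Z : C) (f : hom W X) (g : hom X Y) (h : hom Y Z)
      (a : A) (m : M) (b : B),
    piece A f a -> piece M g m -> piece B h b ->
    piece M (h \oc g \oc f) (rhoE (tens a b) m);
  rhoE_noncomp : forall (W X X' Y Y' Z : C) (f : hom W X) (g : hom X' Y)
      (h : hom Y' Z) (a : A) (m : M) (b : B),
    X <> X' \/ Y <> Y' ->
    piece A f a -> piece M g m -> piece B h b ->
    rhoE (tens a b) m = 0;
  rhoE_mul : forall (V W X Y Z T : C) (f1 : hom V W) (f2 : hom W X)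
      (g : hom X Y) (h2 : hom Y Z) (h1 : hom Z T)
      (a1 a2 : A) (b1 b2 : B) (m : M),
    piece A f1 a1 -> piece A f2 a2 -> piece M g m ->
    piece B h2 b2 -> piece B h1 b1 ->
    rhoE (env_mul (tens a1 b1) (tens a2 b2)) m =
      (uval (alpha C f1 f2 g)
       * uinv (alpha C (g \oc f2 \oc f1) h2 h1)
       * uval (alpha C f1 (g \oc f2) h2))
      *: rhoE (tens a1 b1) (rhoE (tens a2 b2) m);
  rhoE1 : forall (X Y : C) (g : hom X Y) (m : M),
    piece M g m ->
    rhoE (tens (aone A X) (aone B Y)) m =
      (uval (lunitor u g) * uval (runitor u g)) *: m }.

(* Main.v *)
From mathcomp Require Import all_boot all_algebra.
From mathcomp Require Import ring boolp.
Require Import Defs.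

Set Implicit Arguments.
Unset Strict Implicit.
Unset Printing Implicit Defensive.

Import GRing.Theory.
Local Open Scope ring_scope.

(* A bimodule becomes an env-module by acting with [a (x) b] as
    [(a . m) . b]; the cocycle condition turns the bimodule axioms into (E.I)
    with no correcting scalar.  Conversely, for homogeneous elements,
    [m . b] is [1_X (x) b] acting on [m], up to [alpha (Id, Id, |m|)], and
    [a . m] is [a (x) 1_Y] acting on [m], up to the inverse of
    [alpha (|m| o |a|, Id, Id)].  As the units [1_X], [1_Y] and the scalars
    depend on the degree, these formulas are extended from the homogeneous
    pieces by linearity.  The scalars match because [alpha] is determined by
    [alpha (Id, Id, -)] and [alpha (-, Id, Id)] as soon as one of its arguments
    is an identity. *)

(** * Linearity as a proposition *)

Section LinearProp.
Variables (k : comPzRingType) (U V : lmodType k) (f : U -> V).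
Hypothesis lin_f : linear f.

Lemma linear_prop0 : f 0 = 0.
Proof. by have := lin_f (-1) 0 0; rewrite scaler0 addr0 scaleN1r addNr. Qed.

Lemma linear_propD x y : f (x + y) = f x + f y.
Proof. by have := lin_f 1 x y; rewrite !scale1r. Qed.

Lemma linear_propZ c x : f (c *: x) = c *: f x.
Proof. by have := lin_f c x 0; rewrite linear_prop0 !addr0. Qed.

Lemma linear_prop_sum (I : Type) (r : seq I) (P : pred I) (F : I -> U) :
  f (\sum_(i <- r | P i) F i) = \sum_(i <- r | P i) f (F i).
Proof. exact: (big_morph f linear_propD linear_prop0). Qed.

End LinearProp.

Lemma linear_prop_comp (k : comPzRingType) (U V W : lmodType k)
    (f : V -> W) (g : U -> V) :
  linear f -> linear g -> linear (fun x => f (g x)).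
Proof. by move=> lin_f lin_g c x y; rewrite lin_g lin_f. Qed.

Lemma scale_linear (k : comPzRingType) (V : lmodType k) (c : k) :
  linear (fun x : V => c *: x).
Proof. by move=> d x y; rewrite scalerDr !scalerA mulrC. Qed.

(** * Extending degree-dependent linear maps from the homogeneous pieces *)

Section GradedExtension.
Variables (k : comPzRingType) (C : category) (M : graded_module k C).

Lemma pieceZ (X Y : C) (f : hom X Y) c (x : M) :
  piece M f x -> piece M f (c *: x).
Proof. by move=> px; rewrite -[_ *: _]addr0; apply: pieceP px (piece0 M f). Qed.

Lemma piece_sum (X Y : C) (f : hom X Y) (I : Type) (r : seq I) (P : pred I)
    (F : I -> M) :
  (forall i, P i -> piece M f (F i)) -> piece M f (\sum_(i <- r | P i) F i).
Proof.
move=> pF; apply: big_ind => //; first exact: piece0.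
by move=> x y px py; rewrite -[x]scale1r; exact: pieceP.
Qed.

(** Length, degrees and terms are bundled into one value, so that a single [cid] can choose them. *)
Definition decomposition (v : M) (t : {n & ('I_n -> mor C * M)%type}) :=
  (forall i, piece M (arr (projT2 t i).1) (projT2 t i).2)
  /\ v = \sum_i (projT2 t i).2.

Lemma decomposition_ex v : exists t, decomposition v t.
Proof.
have [n [d [x [px ->]]]] := piece_span v.
by exists (existT _ n (fun i => (d i, x i))).
Qed.

Section Ext.
Variable N : lmodType k.
Implicit Types T : mor C -> M -> N.

(* Independent of the chosen decomposition only when every [T d] is linear. *)
Definition graded_ext T (v : M) : N :=
  let t := projT1 (cid (decomposition_ex v)) in
  \sum_i T (projT2 t i).1 (projT2 t i).2.

(** All three extensions sum over the same chosen decomposition of [v]. This gives linearity in the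
    acting algebra element. *)
Lemma graded_ext_comb T T1 T2 c v :
  (forall d x, T d x = c *: T1 d x + T2 d x) ->
  graded_ext T v = c *: graded_ext T1 v + graded_ext T2 v.
Proof.
move=> TE; rewrite /graded_ext scaler_sumr -big_split /=.
by apply: eq_bigr => i _; rewrite TE.
Qed.

Variable T : mor C -> M -> N.
Hypothesis lin_T : forall d, linear (T d).

(** Grouping terms by degree makes the degrees distinct, so [piece_indep] kills each group sum, and
    [T] is linear on each group. This is what makes [graded_ext] well defined. *)
Lemma homogeneous_sum0 (I : finType) (d : I -> mor C) (x : I -> M) :
  (forall i, piece M (arr (d i)) (x i)) -> \sum_i x i = 0 ->
  \sum_i T (d i) (x i) = 0.
Proof.
(* [{classic mor C}] supplies the equality test on degrees; [s] lists them without repetition, [p i]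
   is the position of [d i] in [s], and [e] reads a position back. *)
move=> px x0; pose s := undup [seq (d i : {classic mor C}) | i : I].
have ltds i : (index (d i : {classic mor C}) s < size s)%N.
  by rewrite index_mem mem_undup; apply: image_f.
pose p i := Ordinal (ltds i).
pose e j : mor C := tnth (in_tuple s) j.
have ep i : e (p i) = d i.
  rewrite /e (tnth_nth (d i : {classic mor C})) /=.
  by apply: (@nth_index {classic mor C}); rewrite -index_mem.
have e_inj : injective e.
  apply: (elimT (@tuple_uniqP _ {classic mor C} (in_tuple s))).
  exact: undup_uniq.
pose y j := \sum_(i | p i == j) x i.
have y0 j : y j = 0.
  apply: piece_indep e_inj _ _ j => [j|].
    by apply: piece_sum => i /eqP <-; rewrite ep.
  by rewrite -[RHS]x0 [RHS](partition_big p xpredT).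
rewrite (partition_big p xpredT) //= big1 // => j _.
rewrite (eq_bigr (fun i => T (e j) (x i))).
  by rewrite -linear_prop_sum // -/(y j) y0 linear_prop0.
by move=> i /eqP <-; rewrite ep.
Qed.

(** The given decomposition and the negated chosen one, indexed together by a disjoint union, form a
    homogeneous family with sum zero. *)
Lemma graded_ext_sum (I : finType) (d : I -> mor C) (x : I -> M) :
  (forall i, piece M (arr (d i)) (x i)) ->
  graded_ext T (\sum_i x i) = \sum_i T (d i) (x i).
Proof.
move=> px; rewrite /graded_ext.
case: cid => -[n t] [/= pt xE].
pose d' (i : I + 'I_n) := match i with inl i => d i | inr j => (t j).1 end.
pose x' (i : I + 'I_n) :=
  match i with inl i => x i | inr j => -1 *: (t j).2 end.
have px' i : piece M (arr (d' i)) (x' i).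
  by case: i => [i|j] //=; exact: pieceZ.
have := homogeneous_sum0 px'; rewrite !big_sumType /= -scaler_sumr xE.
rewrite scaleN1r subrr => /(_ erefl).
under [X in _ + X]eq_bigr do rewrite linear_propZ // scaleN1r.
by rewrite sumrN => /eqP; rewrite subr_eq0 => /eqP.
Qed.

Lemma graded_ext_piece (X Y : C) (f : hom X Y) (x : M) :
  piece M f x -> graded_ext T x = T (Mor f) x.
Proof.
move=> px; have := @graded_ext_sum 'I_1 (fun=> Mor f) (fun=> x).
by rewrite !big_ord1; apply.
Qed.

Lemma graded_ext_linear : linear (graded_ext T).
Proof.
move=> c v w; have [[n s] [/= ps ->]] := decomposition_ex v.
have [[m t] [/= pt ->]] := decomposition_ex w.
pose d (i : 'I_n + 'I_m) :=
  match i with inl i => (s i).1 | inr j => (t j).1 end.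
pose x (i : 'I_n + 'I_m) :=
  match i with inl i => c *: (s i).2 | inr j => (t j).2 end.
have px i : piece M (arr (d i)) (x i).
  by case: i => [i|j] //=; exact: pieceZ.
have := graded_ext_sum px; rewrite !big_sumType /= -scaler_sumr => ->.
rewrite (graded_ext_sum ps) (graded_ext_sum pt) scaler_sumr; congr (_ + _).
by apply: eq_bigr => i _; rewrite linear_propZ.
Qed.

End Ext.
End GradedExtension.

(** * Cancellation and inverses of units *)

Section Units.
Variable k : comPzRingType.
Implicit Types a b c : unitgrp k.

Lemma unitgrp_cancel a x y : uval a * x = uval a * y -> x = y.
Proof.
move=> /(congr1 ( *%R (uinv a))).
by rewrite !mulrA ![uinv a * _]mulrC uvalK !mul1r.
Qed.

Lemma uinvM a b c : uval c = uval a * uval b -> uinv c = uinv a * uinv b.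
Proof.
move=> cE; apply: (@unitgrp_cancel c); rewrite uvalK cE.
by ring: (uvalK a) (uvalK b).
Qed.

(** Serves to isolate the iterated action in (E.I), [d] being the inverse of the scalar in front of
    it. *)
Lemma scaler_solve (V : lmodType k) (c d e : k) (v w : V) :
  d * c = 1 -> e *: v = c *: w -> w = (d * e) *: v.
Proof. by move=> dc /(congr1 (GRing.scale d)); rewrite !scalerA dc scale1r. Qed.

End Units.

(** * Values of the associator at identities *)

Section Associator.
Variables (k : comPzRingType) (C : grading_category k).

Lemma associator_pentagon (V W X Y Z : C) (f1 : hom V W) (f2 : hom W X)
    (f3 : hom X Y) (f4 : hom Y Z) :
  uval (alpha C f1 f2 f3) * uval (alpha C f1 (f3 \oc f2) f4)
    * uval (alpha C f2 f3 f4)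
  = uval (alpha C f1 f2 (f4 \oc f3)) * uval (alpha C (f2 \oc f1) f3 f4).
Proof.
rewrite -[RHS]mulr1 -(alpha_cocycle f1 f2 f3 f4).
by ring: (uvalK (alpha C f1 f2 (f4 \oc f3)))
         (uvalK (alpha C (f2 \oc f1) f3 f4)).
Qed.

(** In the pentagon at a quadruple with two adjacent identities, one factor occurs on both sides and
    cancels. The quadruple is [(f, g, Id, Id)] here, then [(Id, Id, f, g)] and [(f, Id, Id, g)] in
    the next two lemmas. *)
Lemma alpha_id_right (X Y Z : C) (f : hom X Y) (g : hom Y Z) :
  uval (alpha C (g \oc f) (idm Z) (idm Z))
  = uval (alpha C f g (idm Z)) * uval (alpha C g (idm Z) (idm Z)).
Proof.
have := associator_pentagon f g (idm Z) (idm Z); rewrite !comp_idl -mulrA.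
by move/unitgrp_cancel.
Qed.

Lemma alpha_id_left (X Y Z : C) (f : hom X Y) (g : hom Y Z) :
  uval (alpha C (idm X) (idm X) (g \oc f))
  = uval (alpha C (idm X) (idm X) f) * uval (alpha C (idm X) f g).
Proof.
have := associator_pentagon (idm X) (idm X) f g; rewrite !comp_idr.
by rewrite mulrC [RHS]mulrC => /unitgrp_cancel.
Qed.

Lemma alpha_id_mid (X Y Z : C) (f : hom X Y) (g : hom Y Z) :
  uval (alpha C f (idm Y) g)
  = uval (alpha C f (idm Y) (idm Y)) * uval (alpha C (idm Y) (idm Y) g).
Proof.
have := associator_pentagon f (idm Y) (idm Y) g.
rewrite !comp_idr !comp_idl mulrAC [_ * _ * uval _]mulrC.
by move/unitgrp_cancel.
Qed.

Lemma alpha_id_outer (X Y : C) (f : hom X Y) :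
  uval (alpha C (idm X) f (idm Y)) = 1.
Proof.
have := alpha_id_right (idm X) f; rewrite comp_idr mulrC -{1}[uval _]mulr1.
by move/unitgrp_cancel.
Qed.

Lemma alpha_id (X : C) : uval (alpha C (idm X) (idm X) (idm X)) = 1.
Proof. exact: alpha_id_outer. Qed.

End Associator.

(** * From bimodules to modules over the enveloping algebra *)

Section EnvOfBimodule.
Variables (k : comPzRingType) (C : grading_category k) (u : unitors k C).
Variables (A B : graded_algebra u) (M : graded_module k C).
Variables (rhoL : A -> M -> M) (rhoR : M -> B -> M).
Hypothesis bimod : is_graded_bimodule rhoL rhoR.

Definition env_act (x : tensor A B) (m : M) : M :=
  tlift (fun a b => rhoR (rhoL a m) b) x.

Let act_bilinear m : is_bilinear (fun a b => rhoR (rhoL a m) b).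
Proof.
have [[_ linL] _ _] := rhoL_graded bimod.
have [[linRr linRl] _ _] := rhoR_graded bimod.
split=> [a | b]; first exact: linRr.
exact: linear_prop_comp (linRl b) (linL m).
Qed.

Lemma env_act_tens a b m : env_act (tens a b) m = rhoR (rhoL a m) b.
Proof. exact: (tlift_tens (act_bilinear m)). Qed.

Lemma env_act_bilinear : is_bilinear env_act.
Proof.
have [[linL _] _ _] := rhoL_graded bimod.
have [[_ linR] _ _] := rhoR_graded bimod.
split=> [x c m m' | m]; last exact: (tlift_linear (act_bilinear m)).
by apply: tlift_comb => a b; rewrite linL linR.
Qed.

Lemma env_act_graded : is_graded_env_module env_act.
Proof.
have [[linLm _] gradL zeroL] := rhoL_graded bimod.
have [[linRb linRm] gradR zeroR] := rhoR_graded bimod.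
split; first exact: env_act_bilinear.
- move=> W X Y Z f g h a m b pa pm pb.
  by rewrite env_act_tens -comp_assoc; apply: gradR => //; apply: gradL.
- move=> W X X' Y Y' Z f g h a m b neq pa pm pb; rewrite env_act_tens.
  (* If [X <> X'] the left action already vanishes; otherwise the mismatch is at [Y] and the right
     action vanishes. *)
  have [XX'|XX'] := EM (X = X'); last first.
    by rewrite (zeroL _ _ _ _ _ _ _ _ XX' pa pm); exact: (linear_prop0 (linRm b)).
  case: neq => [//|YY']; subst X'.
  exact: (zeroR _ _ _ _ _ _ _ _ YY' (gradL _ _ _ _ _ _ _ pa pm) pb).
- move=> V W X Y Z T f1 f2 g h2 h1 a1 a2 b1 b2 m pa1 pa2 pm pb2 pb1.
  rewrite env_mul_tens !env_act_tens.
  have p2 := gradL _ _ _ _ _ _ _ pa2 pm.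
  have p12 := gradL _ _ _ _ _ _ _ pa1 p2.
  (* The three factors of the scalar in (E.I) come, in order, from [rhoL_mul], from [rhoR_mul] read
     backwards (hence the inverse), and from [rhoLR]. *)
  rewrite (rhoL_mul bimod pa1 pa2 pm) (linear_propZ (linRm _)).
  have /(congr1 (GRing.scale (uinv (alpha C (g \oc f2 \oc f1) h2 h1)))) :=
    rhoR_mul bimod p12 pb2 pb1.
  rewrite scalerA [uinv _ * _]mulrC uvalK scale1r => <-.
  rewrite (rhoLR bimod pa1 p2 pb2) (linear_propZ (linRm _)) !scalerA.
  by congr (_ *: _).
- move=> X Y g m pm; rewrite env_act_tens (rhoL1 bimod pm).
  by rewrite (linear_propZ (linRm _)) (rhoR1 bimod pm) scalerA.
Qed.

End EnvOfBimodule.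

(** * From modules over the enveloping algebra to bimodules *)

Section BimoduleOfEnv.
Variables (k : comPzRingType) (C : grading_category k) (u : unitors k C).
Hypothesis typ_u : typical_unitors u.
Variables (A B : graded_algebra u) (M : graded_module k C).
Variable rhoE : tensor A B -> M -> M.
Hypothesis env : is_graded_env_module rhoE.

(** The inner extension picks the unit from the degree of [m]; the outer one reads the scalar off
    the degree of the result, so [a] is never decomposed. *)
Definition left_act (a : A) (m : M) : M :=
  graded_ext
    (fun d n => uinv (alpha C (arr d) (idm (tgt d)) (idm (tgt d))) *: n)
    (graded_ext (fun d => rhoE (tens a (aone B (tgt d)))) m).

Definition right_act (m : M) (b : B) : M :=
  graded_ext (fun d n => uval (alpha C (idm (src d)) (idm (src d)) (arr d))
                         *: rhoE (tens (aone A (src d)) b) n) m.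

Let tensZ c d (a : A) (b : B) : tens (c *: a) (d *: b) = (c * d) *: tens a b.
Proof.
have [tl tr] := tens_bilinear A B.
by rewrite (linear_propZ (tr _)) (linear_propZ (tl _)) scalerA.
Qed.

Let rhoE_linr x : linear (rhoE x).
Proof. exact: (rhoE_bilinear env).1. Qed.

Let rhoE_linl m : linear (rhoE^~ m).
Proof. exact: (rhoE_bilinear env).2. Qed.

Let rhoEZ c x m : rhoE (c *: x) m = c *: rhoE x m.
Proof. exact: (linear_propZ (rhoE_linl m)). Qed.

Let lin_corr (d : mor C) : linear (fun n : M =>
  uinv (alpha C (arr d) (idm (tgt d)) (idm (tgt d))) *: n).
Proof. exact: scale_linear. Qed.

Let lin_right b (d : mor C) : linear (fun n : M =>
  uval (alpha C (idm (src d)) (idm (src d)) (arr d))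
    *: rhoE (tens (aone A (src d)) b) n).
Proof. apply: linear_prop_comp (rhoE_linr _); exact: scale_linear. Qed.

Lemma left_act_bilinear : is_bilinear left_act.
Proof.
split=> [a | m c a a'].
  apply: (linear_prop_comp (graded_ext_linear lin_corr)).
  by apply: graded_ext_linear => d.
rewrite /left_act -(graded_ext_linear lin_corr); congr graded_ext.
apply: graded_ext_comb => d x.
by rewrite ((tens_bilinear A B).2 _) rhoE_linl.
Qed.

Lemma right_act_bilinear : is_bilinear right_act.
Proof.
split=> [m c b b' | b]; last exact: graded_ext_linear (lin_right b).
apply: graded_ext_comb => d x.
by rewrite ((tens_bilinear A B).1 _) rhoE_linl scale_linear.
Qed.

Section Homogeneous.
Variables (W X Y Z : C) (f : hom W X) (g : hom X Y) (h : hom Y Z).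
Variables (a : A) (m : M) (b : B).
Hypotheses (pa : piece A f a) (pm : piece M g m) (pb : piece B h b).

Lemma piece_env1r : piece M (g \oc f) (rhoE (tens a (aone B Y)) m).
Proof.
by have := rhoE_piece env pa pm (aone_piece B Y); rewrite comp_idl.
Qed.

Lemma piece_env1l : piece M (h \oc g) (rhoE (tens (aone A X) b) m).
Proof.
by have := rhoE_piece env (aone_piece A X) pm pb; rewrite comp_idr.
Qed.

Lemma left_act_piece : left_act a m =
  uinv (alpha C (g \oc f) (idm Y) (idm Y)) *: rhoE (tens a (aone B Y)) m.
Proof.
rewrite /left_act (graded_ext_piece _ pm) /=; last by move=> d.
by rewrite (graded_ext_piece _ piece_env1r).
Qed.

Lemma right_act_piece : right_act m b =
  uval (alpha C (idm X) (idm X) g) *: rhoE (tens (aone A X) b) m.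
Proof. by rewrite /right_act (graded_ext_piece (lin_right b) pm). Qed.

End Homogeneous.

Lemma left_act_graded : is_graded_pairing left_act.
Proof.
split; first exact: left_act_bilinear.
  move=> X Y Z g1 g2 a m pa pm.
  by rewrite (left_act_piece pa pm); apply/pieceZ/piece_env1r.
move=> X Y Y' Z g1 g2 a m YY' pa pm.
rewrite /left_act (graded_ext_piece _ pm) /=; last by move=> d.
rewrite (rhoE_noncomp env (or_introl YY') pa pm (aone_piece B Z)).
exact: linear_prop0 (graded_ext_linear lin_corr).
Qed.

Lemma right_act_graded : is_graded_pairing right_act.
Proof.
split; first exact: right_act_bilinear.
  move=> X Y Z g1 g2 m b pm pb.
  by rewrite (right_act_piece _ pm); apply/pieceZ/piece_env1l.
move=> X Y Y' Z g1 g2 m b YY' pm pb; rewrite (right_act_piece _ pm).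
by rewrite (rhoE_noncomp env (or_intror YY') (aone_piece A X) pm pb) scaler0.
Qed.

Lemma lunitorE (X Y : C) (g : hom X Y) :
  uval (lunitor u g) = uinv (alpha C (idm X) (idm X) g).
Proof. exact: (typ_u g).1. Qed.

Lemma runitorE (X Y : C) (g : hom X Y) :
  uval (runitor u g) = uval (alpha C g (idm Y) (idm Y)).
Proof. exact: (typ_u g).2. Qed.

(** Allows a unit to be split into a product, so that (E.I) applies to [amul a a'] or [amul b b']
    paired with a unit. *)
Lemma aoneM (D : graded_algebra u) (X : C) :
  amul (aone D X) (aone D X) = aone D X.
Proof.
by rewrite (amul1r (aone_piece D X)) runitorE alpha_id scale1r.
Qed.

(** (E.I) for the product of [tens 1_W b] and [tens a 1_Y], which is [tens a b] up to two left
    unitors. *)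
Lemma right_left_act (W X Y Z : C) (f : hom W X) (g : hom X Y) (h : hom Y Z)
    (a : A) (m : M) (b : B) :
  piece A f a -> piece M g m -> piece B h b ->
  right_act (left_act a m) b = rhoE (tens a b) m.
Proof.
move=> pa pm pb; have [_ linR] := right_act_bilinear.
rewrite (left_act_piece pa pm) (linear_propZ (linR b)).
rewrite (right_act_piece _ (piece_env1r pa pm)).
have := rhoE_mul env (aone_piece A W) pa pm (aone_piece B Y) pb.
rewrite env_mul_tens (amul1l pa) (amul1l pb) tensZ rhoEZ !comp_idr.
rewrite !lunitorE alpha_id_outer mulr1.
rewrite (uinvM (alpha_id_mid (g \oc f) h)).
(* The witness inverts what is left of the (E.I) scalar: its last factor is 1 by [alpha_id_outer],
   and its middle one was split by [alpha_id_mid]. *)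
move/(@scaler_solve _ _ _ (uinv (alpha C (idm W) f g)
  * (uval (alpha C (g \oc f) (idm Y) (idm Y))
     * uval (alpha C (idm Y) (idm Y) h)))).
move=> ->; last first.
  by ring: (uvalK (alpha C (idm W) f g))
    (uvalK (alpha C (g \oc f) (idm Y) (idm Y)))
    (uvalK (alpha C (idm Y) (idm Y) h)).
rewrite !scalerA -[RHS]scale1r alpha_id_left; congr (_ *: _).
by ring: (uvalK (alpha C (idm W) f g))
    (uvalK (alpha C (g \oc f) (idm Y) (idm Y)))
    (uvalK (alpha C (idm Y) (idm Y) h)) (uvalK (alpha C (idm W) (idm W) f)).
Qed.

(** (E.I) for the product of [tens a 1_X] and [tens 1_Z]-sided [b] in the other order: [tens a 1_Z]
    times [tens 1_X b] is [tens a b] up to two right unitors. The remaining scalar is the one that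
    [rhoLR] requires. *)
Lemma left_right_act (W X Y Z : C) (f : hom W X) (g : hom X Y) (h : hom Y Z)
    (a : A) (m : M) (b : B) :
  piece A f a -> piece M g m -> piece B h b ->
  left_act a (right_act m b) = uinv (alpha C f g h) *: rhoE (tens a b) m.
Proof.
move=> pa pm pb; have [linL _] := left_act_bilinear.
rewrite (right_act_piece _ pm) (linear_propZ (linL a)).
rewrite (left_act_piece pa (piece_env1l pm pb)).
have := rhoE_mul env pa (aone_piece A X) pm pb (aone_piece B Z).
rewrite env_mul_tens (amul1r pa) (amul1r pb) tensZ rhoEZ !comp_idr.
rewrite !runitorE (alpha_id_mid f g).
(* Reassociated so as to match the scalar of [left_act] in degree [h \oc g \oc f]. *)
have hE := alpha_id_right (g \oc f) h; rewrite comp_assoc in hE.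
move/(@scaler_solve _ _ _ (uinv (alpha C f (idm X) (idm X))
  * uinv (alpha C (idm X) (idm X) g) * uval (alpha C (g \oc f) h (idm Z))
  * uinv (alpha C f g h))).
move=> ->; last first.
  by ring: (uvalK (alpha C f (idm X) (idm X)))
    (uvalK (alpha C (idm X) (idm X) g)) (uvalK (alpha C (g \oc f) h (idm Z)))
    (uvalK (alpha C f g h)).
rewrite !scalerA; congr (_ *: _); rewrite (uinvM hE).
by ring: (uvalK (alpha C f (idm X) (idm X)))
    (uvalK (alpha C (idm X) (idm X) g)) (uvalK (alpha C (g \oc f) h (idm Z)))
    (uvalK (alpha C h (idm Z) (idm Z))).
Qed.

Lemma left_act_mul (W X Y Z : C) (f : hom W X) (f' : hom X Y) (g : hom Y Z)
    (a a' : A) (m : M) :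
  piece A f a -> piece A f' a' -> piece M g m ->
  left_act (amul a a') m
  = uval (alpha C f f' g) *: left_act a (left_act a' m).
Proof.
move=> pa pa' pm; have [linL _] := left_act_bilinear.
have [_ gradA _] := amul_graded A.
rewrite (left_act_piece (gradA _ _ _ _ _ _ _ pa pa') pm).
rewrite (left_act_piece pa' pm) (linear_propZ (linL a)).
(* Only the unit on the left-hand side is split, which turns that side into the action of
   [tens a 1_Z] times [tens a' 1_Z]. *)
rewrite (left_act_piece pa (piece_env1r pa' pm)) -{1}aoneM -env_mul_tens.
rewrite (rhoE_mul env pa pa' pm (aone_piece B Z) (aone_piece B Z)).
rewrite !scalerA; congr (_ *: _); rewrite !comp_assoc.
have hE := alpha_id_right f (g \oc f').
rewrite (uinvM hE).
by ring: (uvalK (alpha C f (g \oc f') (idm Z))).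
Qed.

Lemma right_act_mul (W X Y Z : C) (g : hom W X) (h : hom X Y) (h' : hom Y Z)
    (m : M) (b b' : B) :
  piece M g m -> piece B h b -> piece B h' b' ->
  right_act (right_act m b) b'
  = uval (alpha C g h h') *: right_act m (amul b b').
Proof.
move=> pm pb pb'; have [_ linR] := right_act_bilinear.
rewrite !(right_act_piece _ pm) (linear_propZ (linR b')).
(* The third unit is the one on the right-hand side; splitting it gives [tens 1_W b'] times
   [tens 1_W b], since the product of [B] is reversed. *)
rewrite (right_act_piece _ (piece_env1l pm pb)) -{3}aoneM -env_mul_tens.
rewrite (rhoE_mul env (aone_piece A W) (aone_piece A W) pm pb pb').
rewrite !scalerA; congr (_ *: _); rewrite !comp_idr alpha_id_left.
by ring: (uvalK (alpha C g h h')).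
Qed.

Lemma bimodule_of_env : is_graded_bimodule left_act right_act.
Proof.
split; [exact: left_act_graded | exact: right_act_graded
  | exact: left_act_mul | exact: right_act_mul | | |].
- move=> W X Y Z f g h a m b pa pm pb.
  rewrite (right_left_act pa pm pb) (left_right_act pa pm pb) scalerA uvalK.
  by rewrite scale1r.
(* The normalising scalar of [left_act] cancels the right unitor in (E.II) and leaves the left one;
   symmetrically for [right_act] below. *)
- move=> X Y g m pm; rewrite (left_act_piece (aone_piece A X) pm).
  rewrite (rhoE1 env pm) scalerA comp_idr runitorE; congr (_ *: _).
  by ring: (uvalK (alpha C g (idm Y) (idm Y))).
- move=> X Y g m pm; rewrite (right_act_piece _ pm).
  rewrite (rhoE1 env pm) scalerA lunitorE; congr (_ *: _).
  by ring: (uvalK (alpha C (idm X) (idm X) g)).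
Qed.

End BimoduleOfEnv.

Theorem proposition2p14 (k : comPzRingType) (C : grading_category k)
    (u : unitors k C) (hu : typical_unitors u) (A B : graded_algebra u)
    (M : graded_module k C) :
  (forall rhoE : tensor A B -> M -> M, is_graded_env_module rhoE ->
     exists (rhoL : A -> M -> M) (rhoR : M -> B -> M),
       is_graded_bimodule rhoL rhoR)
  /\
  (forall (rhoL : A -> M -> M) (rhoR : M -> B -> M),
     is_graded_bimodule rhoL rhoR ->
     exists rhoE : tensor A B -> M -> M, is_graded_env_module rhoE).
Proof.
split=> [rhoE env | rhoL rhoR bimod].
  by exists (left_act rhoE), (right_act rhoE); exact: bimodule_of_env.
by exists (env_act rhoL rhoR); exact: env_act_graded.
Qed.
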